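(* Let $n\geq 1$ and $N_1,\dots,N_n\geq 0$ be integers. Let $Q$ be the quiver with vertices $1,\dots,n$, arrows $x_{i}:i-1\to i$ for $2\le i\le n$, and $N_i$ loops at vertex $i$ for each $i$. Let $A(n)=\Bbbk Q/(\geq 2)$. Then $$\operatorname{fpd}\big(A(n)\text{-mod}\big)=\max\{N_1,\dots,N_n\}.$$
   Context: $\Bbbk$ is an algebraically closed field; $\Bbbk Q$ is the path algebra with $e_i\alpha=\delta_{i,t(\alpha)}\alpha$, $\alpha e_j=\delta_{j,s(\alpha)}\alpha$; $(\geq 2)$ is the ideal generated by paths of length $\geq 2$; $A\text{-mod}$ is the category of finite-dimensional left $A$-modules. For a $\Bbbk$-linear abelian category $\mathcal C$: an object $M$ is a brick if $\mathrm{Hom}(M,M)=\Bbbk$; a finite set $\phi=\{X_1,\dots,X_m\}$ of nonzero objects is a brick set if each $X_i$ is a brick and $\dim\mathrm{Hom}(X_i,X_j)=\delta_{ij}$; its adjacency matrix is $A(\phi)=(\dim\mathrm{Ext}^1_{\mathcal C}(X_i,X_j))_{i,j}$; and $\operatorname{fpd}(\mathcal C)=\sup_{\phi}\rho(A(\phi))$, the supremum over all brick sets of the spectral radius $\rho$. *)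

(* Defs.v *)
From HB Require Import structures.
From mathcomp Require Import all_boot all_order all_algebra all_field.
Set Implicit Arguments. Unset Strict Implicit. Unset Printing Implicit Defensive.
Import Order.TTheory GRing.Theory Num.Theory.
Local Open Scope ring_scope.

(* Finite-dimensional left modules over A = k Q / (>= 2), Q a quiver with   *)
(* vertices 'I_n and arrow set Ar (source s, target t).                     *)
(* A module is k^d (column vectors) together with the images of the basis   *)
(* elements e_i and alpha of A, subject to the multiplication table of A:   *)
(*   e_i e_j = delta_ij e_i,  sum_i e_i = 1,                                *)
(*   e_i alpha = delta_{i,t alpha} alpha,  alpha e_j = delta_{j,s alpha} alpha, *)
(*   alpha beta = 0 (all paths of length >= 2 vanish).                      *)

Record qrep (F : fieldType) (n : nat) (Ar : finType) := QRep {
  qdim : nat;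
  qidem : 'I_n -> 'M[F]_qdim;
  qarr : Ar -> 'M[F]_qdim }.

Section Rad2.
Variables (F : fieldType) (n : nat) (Ar : finType) (s t : Ar -> 'I_n).

Definition qgen (M : qrep F n Ar) (g : 'I_n + Ar) : 'M[F]_(qdim M) :=
  match g with inl i => qidem M i | inr a => qarr M a end.

Definition is_rad2_module (M : qrep F n Ar) : Prop :=
  [/\ forall i j, qidem M i *m qidem M j = (if i == j then qidem M i else 0),
      \sum_i qidem M i = 1%:M,
      forall i a, qidem M i *m qarr M a = (if i == t a then qarr M a else 0),
      forall a j, qarr M a *m qidem M j = (if j == s a then qarr M a else 0)
    & forall a b, qarr M a *m qarr M b = 0].

Definition hom_defect (M N : qrep F n Ar) (f : 'M[F]_(qdim N, qdim M)) :
    {ffun 'I_n + Ar -> 'M[F]_(qdim N, qdim M)} :=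
  [ffun g => f *m qgen M g - qgen N g *m f].

Definition dimHom (M N : qrep F n Ar) : nat :=
  \dim (lker (linfun (@hom_defect M N))).

(* Ext^1_A(M,N) = classes of extensions 0 -> N -> E -> M -> 0.  Every such E *)
(* is k^{dim N + dim M} with generators acting by [[N_g, d_g],[0, M_g]];     *)
(* the A-relations for E amount to the linearised relations below (cocycles) *)
(* and E is equivalent to the extension given by d' iff d - d' is a          *)
(* coboundary g |-> N_g phi - phi M_g.  Ext^1 = cocycles / coboundaries.     *)
Definition rel_index := ((('I_n * 'I_n) + unit + ('I_n * Ar) + (Ar * 'I_n)
                        + (Ar * Ar))%type).

Definition cocycle_defect (M N : qrep F n Ar)
    (d : {ffun 'I_n + Ar -> 'M[F]_(qdim N, qdim M)}) :
    {ffun rel_index -> 'M[F]_(qdim N, qdim M)} :=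
  [ffun r => match r with
   | inl (inl (inl (inl (i, j)))) =>
       qidem N i *m d (inl j) + d (inl i) *m qidem M j
         - (if i == j then d (inl i) else 0)
   | inl (inl (inl (inr _))) => \sum_i d (inl i)
   | inl (inl (inr (i, a))) =>
       qidem N i *m d (inr a) + d (inl i) *m qarr M a
         - (if i == t a then d (inr a) else 0)
   | inl (inr (a, j)) =>
       qarr N a *m d (inl j) + d (inr a) *m qidem M j
         - (if j == s a then d (inr a) else 0)
   | inr (a, b) => qarr N a *m d (inr b) + d (inr a) *m qarr M b
   end].

Definition coboundary (M N : qrep F n Ar) (phi : 'M[F]_(qdim N, qdim M)) :
    {ffun 'I_n + Ar -> 'M[F]_(qdim N, qdim M)} :=
  [ffun g => qgen N g *m phi - phi *m qgen M g].

Definition dimExt1 (M N : qrep F n Ar) : nat :=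
  (\dim (lker (linfun (@cocycle_defect M N)))
     - \dim (limg (linfun (@coboundary M N))))%N.

Definition brick_set (m : nat) (X : 'I_m -> qrep F n Ar) : Prop :=
  (forall i, is_rad2_module (X i) /\ (0 < qdim (X i))%N) /\
  (forall i j, dimHom (X i) (X j) = (i == j) :> nat).

Definition adjacency (m : nat) (X : 'I_m -> qrep F n Ar) : 'M[algC]_m :=
  \matrix_(i, j) (dimExt1 (X i) (X j))%:R.

End Rad2.

Definition is_spectral_radius (m : nat) (B : 'M[algC]_m) (r : algC) : Prop :=
  if m == 0%N then r = 0 else
  (exists2 l, eigenvalue B l & `|l| = r) /\
  (forall l, eigenvalue B l -> `|l| <= r).

Definition fpd_values (F : fieldType) (n : nat) (Ar : finType)
    (s t : Ar -> 'I_n) (r : algC) : Prop :=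
  exists m (X : 'I_m -> qrep F n Ar),
    brick_set s t X /\ is_spectral_radius (adjacency s t X) r.

Definition is_sup (S : algC -> Prop) (x : algC) : Prop :=
  x \is Num.real /\
  (forall r, S r -> r <= x) /\
  (forall eps : algC, 0 < eps -> exists2 r, S r & x - eps < r).

Definition fpd_eq (F : fieldType) (n : nat) (Ar : finType)
    (s t : Ar -> 'I_n) (x : algC) : Prop :=
  is_sup (fpd_values F s t) x.

(* The quiver Q of Theorem 5.1 (0-based vertices 0..n-1):                  *)
(*   arrows x_k : k-1 -> k for 1 <= k <= n-1, and N_i loops at vertex i.    *)
Definition arrA (n : nat) (N : 'I_n -> nat) : finType :=
  ({k : 'I_n | (0 < k)%N} + {i : 'I_n & 'I_(N i)})%type.

Definition predo (n : nat) (k : 'I_n) : 'I_n :=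
  Ordinal (leq_ltn_trans (leq_pred k) (ltn_ord k)).

Definition srcA (n : nat) (N : 'I_n -> nat) (a : arrA N) : 'I_n :=
  match a with inl k => predo (val k) | inr l => tag l end.

Definition tgtA (n : nat) (N : 'I_n -> nat) (a : arrA N) : 'I_n :=
  match a with inl k => val k | inr l => tag l end.

(* Main.v *)
(* For a brick [M] over a radical-square-zero algebra, a vertex cannot occur
   both in the top and in the socle unless [M] is simple, since [M -> S -> M]
   would be a nonzero nilpotent endomorphism.  Hence loops act by zero, and as
   the other arrows form a line, [M] is either a simple [S_c] or the length-two
   uniserial module on one arrow.  In a brick set, Hom-orthogonality forces all
   Ext^1 with a uniserial member to vanish, while Ext^1(S_c, S_c') between
   distinct simples is nonzero only for an arrow c -> c'.  So the adjacency
   matrix is triangular with diagonal entries 0 or N_c. *)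
Require Import Defs.
From HB Require Import structures.
From mathcomp Require Import all_boot all_order all_algebra all_field.
Import Order.TTheory GRing.Theory Num.Theory.
Local Open Scope ring_scope.

Set Implicit Arguments. Unset Strict Implicit. Unset Printing Implicit Defensive.

(** With [U] the matrix unit at [(j, k)], the [(i, l)] entry of [W *m U *m G] is [W i j * G k l];
    one nonzero entry of [W] thus annihilates every entry of [G]. *)
Lemma mulmx_sandwich_eq0 (F : fieldType) (m n p q : nat)
    (W : 'M[F]_(m, n)) (G : 'M[F]_(p, q)) :
  (forall U, W *m U *m G = 0) -> W = 0 \/ G = 0.
Proof.
move=> WG0; have [->|W0] := eqVneq W 0; [by left | right].
have /matrix0Pn[i [j Wij]] : W != 0 by [].
apply/matrixP=> k l; rewrite mxE.
have /matrixP/(_ i l) := WG0 (delta_mx j k).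
rewrite mxE (bigD1 k) //= big1 ?addr0 => [|k' k'k].
  rewrite !mxE (bigD1 j) //= big1 ?addr0 => [|j' j'j]; last first.
    by rewrite !mxE (negPf j'j) mulr0.
  by rewrite !mxE !eqxx mulr1 => /eqP; rewrite mulf_eq0 (negPf Wij) => /eqP.
rewrite !mxE big1 ?mul0r // => j' _.
by rewrite !mxE (negPf k'k) andbF mulr0.
Qed.

Lemma scaler_fix (F : fieldType) (V : lmodType F) (l : F) (v : V) :
  v != 0 -> l *: v = v -> l = 1.
Proof.
move=> v0 /eqP; rewrite -[X in _ == X]scale1r -subr_eq0 -scalerBl scaler_eq0.
by rewrite (negPf v0) orbF subr_eq0 => /eqP.
Qed.

(** * Linearity of the defect maps, so that [linfun] evaluates to them, and Hom spaces *)

Section Modules.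
Variables (F : fieldType) (n : nat) (Ar : finType).
Implicit Types M N X : qrep F n Ar.

Lemma hom_defect_is_linear M N : linear (@hom_defect F n Ar M N).
Proof.
move=> a u v; apply/ffunP=> g; rewrite !ffunE.
by rewrite mulmxDl mulmxDr -scalemxAl -scalemxAr scalerBr opprD addrACA.
Qed.
HB.instance Definition _ M N :=
  GRing.isLinear.Build F _ _ _ (@hom_defect F n Ar M N)
    (@hom_defect_is_linear M N).

Lemma coboundary_is_linear M N : linear (@coboundary F n Ar M N).
Proof.
move=> a u v; apply/ffunP=> g; rewrite !ffunE.
by rewrite mulmxDl mulmxDr -scalemxAl -scalemxAr scalerBr opprD addrACA.
Qed.
HB.instance Definition _ M N :=
  GRing.isLinear.Build F _ _ _ (@coboundary F n Ar M N)
    (@coboundary_is_linear M N).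

Lemma cocycle_defect_is_linear (s t : Ar -> 'I_n) M N :
  linear (@cocycle_defect F n Ar s t M N).
Proof.
have ifD (V : lmodType F) (b : bool) (a : F) (u v : V) :
    (if b then a *: u + v else 0) =
    a *: (if b then u else 0) + (if b then v else 0).
  by case: b; rewrite ?scaler0 ?addr0.
have sum2 (V : lmodType F) (a : F) (A B C D : V) :
    a *: A + B + (a *: C + D) = a *: (A + C) + (B + D).
  by rewrite addrACA scalerDr.
have sum3 (V : lmodType F) (a : F) (A B C D G H : V) :
    a *: A + B + (a *: C + D) - (a *: G + H) = a *: (A + C - G) + (B + D - H).
  by rewrite sum2 opprD addrACA scalerBr.
move=> a u v; apply/ffunP=> -[[[[[i j]|[]]|[i b]]|[b j]]|[b c]];
  rewrite !ffunE;
  try by rewrite scaler_sumr -big_split /=; apply: eq_bigr => i _; rewrite !ffunE.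
all: by rewrite ?ifD mulmxDl mulmxDr -scalemxAl -scalemxAr ?sum3 ?sum2.
Qed.
HB.instance Definition _ (s t : Ar -> 'I_n) M N :=
  GRing.isLinear.Build F _ _ _ (@cocycle_defect F n Ar s t M N)
    (@cocycle_defect_is_linear s t M N).

Definition is_hom M N (f : 'M[F]_(qdim N, qdim M)) : Prop :=
  (forall i, f *m qidem M i = qidem N i *m f) /\
  (forall a, f *m qarr M a = qarr N a *m f).

Lemma mem_homP M N (f : 'M[F]_(qdim N, qdim M)) :
  reflect (is_hom f) (f \in lker (linfun (@hom_defect F n Ar M N))).
Proof.
rewrite memv_ker lfunE; apply: (iffP eqP) => [/ffunP f0 | [fe fa]].
  split=> g; [have := f0 (inl g) | have := f0 (inr g)];
    by rewrite !ffunE => /eqP; rewrite subr_eq0 => /eqP.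
by apply/ffunP=> -[i|a]; rewrite !ffunE /= ?fe ?fa subrr.
Qed.

Lemma hom_eq0 M N (f : 'M[F]_(qdim N, qdim M)) :
  dimHom M N = 0%N -> is_hom f -> f = 0.
Proof.
move=> /eqP; rewrite /dimHom dimv_eq0 => /eqP K0 /mem_homP.
by rewrite K0 memv0 => /eqP.
Qed.

(** The identity lies in the kernel computing Hom and is nonzero because [qdim M] is positive, so a
    one-dimensional kernel is its span. *)
Lemma endo_scalar M (f : 'M[F]_(qdim M)) :
  (0 < qdim M)%N -> dimHom M M = 1%N -> is_hom f -> exists l, f = l%:M.
Proof.
move=> M0 K1 /mem_homP Kf.
have K1M : 1%:M \in lker (linfun (@hom_defect F n Ar M M)).
  by apply/mem_homP; split=> g; rewrite mulmx1 mul1mx.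
have : (<[1%:M : 'M[F]_(qdim M)]> == lker (linfun (@hom_defect F n Ar M M)))%VS.
  rewrite eqEdim -memvE K1M /= dim_vline (_ : \dim _ = dimHom M M) // K1.
  by rewrite lt0b -mxrank_eq0 mxrank1 -lt0n.
by move/eqP=> KE; move: Kf; rewrite -KE => /vlineP [l ->]; exists l; rewrite scalemx1.
Qed.

(** * A vanishing criterion for Ext, and the possible shapes of bricks *)

Section Rad2Modules.
Variables s t : Ar -> 'I_n.

(** Here [D] is the arrow part of a cocycle made zero on the idempotents; its three conditions are
    what the cocycle relations then say. [phi] commutes with the idempotents so that its coboundary
    is zero there too. *)
Lemma dimExt1_eq0 M N :
    is_rad2_module s t M -> is_rad2_module s t N ->
    (forall D : Ar -> 'M[F]_(qdim N, qdim M),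
       (forall i a, qidem N i *m D a = if i == t a then D a else 0) ->
       (forall a j, D a *m qidem M j = if j == s a then D a else 0) ->
       (forall a b, qarr N a *m D b + D a *m qarr M b = 0) ->
     exists2 phi, (forall i, qidem N i *m phi = phi *m qidem M i) &
       forall a, D a = qarr N a *m phi - phi *m qarr M a) ->
  dimExt1 s t M N = 0%N.
Proof.
move=> [Me M1 Mea Mae Maa] [Ne N1 Nea Nae Naa] H.
apply/eqP; rewrite subn_eq0; apply/dimvS/subvP=> d.
rewrite memv_ker lfunE => /eqP/ffunP Zd.
pose phi0 := \sum_j qidem N j *m d (inl j).
(* The idempotents span a separable subalgebra, so [d] is a coboundary on it. *)
have de i : d (inl i) = qidem N i *m phi0 - phi0 *m qidem M i.
  rewrite /phi0 mulmx_sumr mulmx_suml -sumrB.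
  (* Compare summands: multiplying the relation for [e_j e_i] by [e_j] on the left gives
     [e_j d_i = e_i e_j d_j - e_j d_j e_i], and the left sides add up to [d_i]. *)
  rewrite (eq_bigr (fun j => qidem N j *m d (inl i))) => [|j _].
    by rewrite -mulmx_suml N1 mul1mx.
  have := Zd (inl (inl (inl (inl (j, i))))); rewrite !ffunE => /eqP.
  rewrite subr_eq0 -mulmxA => /eqP E.
  have := congr1 (mulmx (qidem N j)) E.
  rewrite mulmxDr !mulmxA !Ne eqxx eq_sym.
  case: eqP => [->|_].
    by move=> Ej; rewrite -[X in X - _]Ej addrK.
  by rewrite mulmx0 mul0mx sub0r => /eqP; rewrite addr_eq0 => /eqP ->.
pose D a := d (inr a) - (qarr N a *m phi0 - phi0 *m qarr M a).
have [| | |phi phie Dphi] := H D.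
- move=> i a; have := Zd (inl (inl (inr (i, a)))); rewrite !ffunE => /eqP.
  rewrite subr_eq0 => /eqP E.
  have -> : qidem N i *m D a = qidem N i *m d (inr a) + d (inl i) *m qarr M a
      - qidem N i *m qarr N a *m phi0 + phi0 *m (qidem M i *m qarr M a).
    rewrite /D de !mulmxBr mulmxBl !mulmxA opprB addrA.
    by rewrite [RHS]addrAC -[_ + _ + phi0 *m _ *m _]addrA subrK addrAC.
  rewrite E Nea Mea /D; case: eqP => _; last by rewrite mul0mx mulmx0 subrr add0r.
  by rewrite -addrA opprB [- _ + _]addrC.
- move=> a j; have := Zd (inl (inr (a, j))); rewrite !ffunE => /eqP.
  rewrite subr_eq0 => /eqP E.
  have -> : D a *m qidem M j = qarr N a *m d (inl j) + d (inr a) *m qidem M j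
      - qarr N a *m qidem N j *m phi0 + phi0 *m (qarr M a *m qidem M j).
    rewrite /D de !mulmxBr !mulmxBl !mulmxA opprB addrA.
    have AC (V : zmodType) (x v w z : V) : x + v - w = z - w + x - z + v.
      by rewrite [z - w]addrC [_ + x - z]addrAC addrK [- w + x]addrC addrAC.
    exact: AC.
  rewrite E Nae Mae /D; case: eqP => _; last by rewrite mul0mx mulmx0 subrr add0r.
  by rewrite -addrA opprB [- _ + _]addrC.
- move=> a b; have := Zd (inr (a, b)); rewrite !ffunE => E.
  rewrite /D !mulmxBr !mulmxBl !mulmxA Naa mul0mx sub0r -[phi0 *m _ *m _]mulmxA.
  by rewrite Maa mulmx0 subr0 opprK addrACA E add0r subrr.
apply/memv_imgP; exists (phi0 + phi); rewrite ?memvf // lfunE.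
apply/ffunP=> -[i|a]; rewrite !ffunE /= mulmxDr mulmxDl opprD addrACA.
  by rewrite de phie subrr addr0.
by rewrite -Dphi /D addrC subrK.
Qed.

Definition simple_at c M : Prop :=
  (forall i, qidem M i = if i == c then 1%:M else 0) /\
  (forall a, qarr M a = 0).

(* A power of the length-two uniserial module carried by the arrow [a]. *)
Definition supported_on_arrow a M : Prop :=
  [/\ s a != t a, qidem M (s a) + qidem M (t a) = 1%:M,
      forall b, b != a -> qarr M b = 0
    & exists y, y *m qarr M a = qidem M (s a) /\
                qarr M a *m y = qidem M (t a)].

Definition has_shape (u : 'I_n + Ar) M : Prop :=
  match u with inl c => simple_at c M | inr a => supported_on_arrow a M end.
Definition top_vertex (u : 'I_n + Ar) := match u with inl c => c | inr a => s a end.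
Definition socle_vertex (u : 'I_n + Ar) := match u with inl c => c | inr a => t a end.

(** * Bricks and their extensions when each vertex has at most one non-loop arrow out and one in *)

Section Classification.
Hypothesis src_inj : forall a b,
  s a != t a -> s b != t b -> s a = s b -> a = b.
Hypothesis tgt_inj : forall a b,
  s a != t a -> s b != t b -> t a = t b -> a = b.

(** If all arrows act by zero, each idempotent is an endomorphism, hence 0 or 1. Otherwise a nonzero
    arrow [a] is shown to be invertible from vertex [s a] to vertex [t a], and these two vertices to
    carry all of [M]. *)
Lemma brick_has_shape M :
    is_rad2_module s t M -> (0 < qdim M)%N -> dimHom M M = 1%N ->
  exists u, has_shape u M.
Proof.
move=> [Me M1 Mea Mae Maa] M0 K1.
have nz1 : (1%:M : 'M[F]_(qdim M)) != 0 by rewrite -mxrank_eq0 mxrank1 -lt0n.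
have [/existsP[a Xa0]|/existsPn arr0] := boolP [exists a, qarr M a != 0]; last first.
  have {}arr0 a : qarr M a = 0 by apply/eqP; have := arr0 a; rewrite negbK.
  have [c ec0|e0] := pickP (fun c => qidem M c != 0); last first.
    move: nz1; rewrite -M1 big1 ?eqxx // => i _.
    by apply/eqP; have := e0 i => /negbFE.
  have [l el] : exists l, qidem M c = l%:M.
    apply: endo_scalar => //; split=> [i|a]; last by rewrite arr0 mulmx0 mul0mx.
    by rewrite !Me [c == i]eq_sym; case: eqP => [->|].
  have ec1 : qidem M c = 1%:M.
    have := Me c c; rewrite eqxx {1}el mul_scalar_mx => /(scaler_fix ec0) l1.
    by rewrite el l1.
  exists (inl c); split=> // i; case: eqP => [->//|/eqP ic].
  by rewrite -[LHS]mulmx1 -ec1 Me (negPf ic).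
(* The endomorphism [W U G] is nilpotent, hence vanishes. *)
have sandwich (W G : 'M_(qdim M)) c : (forall b, qarr M b *m W = 0) -> qidem M c *m W = W ->
    (forall b, G *m qarr M b = 0) -> G *m qidem M c = G -> W = 0 \/ G = 0.
  move=> Wb We Gb Ge; apply: mulmx_sandwich_eq0 => U.
  have [l WUG] : exists l, W *m U *m G = l%:M.
    apply: endo_scalar => //; split=> [i|b]; last first.
      by rewrite -!mulmxA Gb !mulmx0 mulmxA Wb mul0mx.
    rewrite -{1}Ge -{2}We !mulmxA Me -!mulmxA Me eq_sym.
    case: eqP => [->|]; last by rewrite !mulmx0 mul0mx.
    by rewrite Ge !mulmxA We.
  have : W *m U *m G *m qarr M a = 0 by rewrite -mulmxA Gb mulmx0.
  rewrite WUG mul_scalar_mx => /eqP; rewrite scaler_eq0 (negPf Xa0) orbF.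
  by move=> /eqP ->; rewrite raddf0.
have eta b : qidem M (t b) *m qarr M b = qarr M b by rewrite Mea eqxx.
have aes b : qarr M b *m qidem M (s b) = qarr M b by rewrite Mae eqxx.
(* The image of [b] is a nonzero part of the socle at [t b], so the top of [M] has no component at
   that vertex. *)
have top0 b (G : 'M_(qdim M)) : qarr M b != 0 -> (forall c, G *m qarr M c = 0) ->
    G *m qidem M (t b) = G -> G = 0.
  move=> b0 Gc Ge; have [] // := sandwich (qarr M b) G (t b) (Maa^~ b) (eta b) Gc Ge.
  by move/eqP; rewrite (negPf b0).
(* Dually, [b] is nonzero on the top at [s b], so the socle has no component there. *)
have soc0 b (W : 'M_(qdim M)) : qarr M b != 0 -> (forall c, qarr M c *m W = 0) ->
    qidem M (s b) *m W = W -> W = 0.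
  move=> b0 Wc We; have [] // := sandwich W (qarr M b) (s b) Wc We (Maa b) (aes b).
  by move/eqP; rewrite (negPf b0).
(* If [s b = t c], then [qarr M b] itself meets the conditions of [top0] for [c]. The case [b = c]
   says that loops act by zero. *)
have nocomp b c : qarr M b != 0 -> qarr M c != 0 -> s b != t c.
  move=> b0 c0; apply: contraNneq b0 => bc; apply/eqP/(top0 c) => //.
  by rewrite -bc.
have nl b : qarr M b != 0 -> s b != t b by move=> b0; apply: nocomp.
(* The rows of the transposed cokernel cut out the image of [a]. By [tgt_inj], [a] is the only
   nonzero arrow into [t a], so [G] kills the radical, and [top0] puts the space at [t a] inside the
   image of [a]. The left inverse [y1] below is dual. *)
have [y0 ay0] : exists y0, qarr M a *m y0 = qidem M (t a).
  pose G := (cokermx (qarr M a)^T)^T *m qidem M (t a).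
  have Ga : (cokermx (qarr M a)^T)^T *m qarr M a = 0.
    by apply: trmx_inj; rewrite trmx_mul trmxK mulmx_coker trmx0.
  have G0 : G = 0.
    apply: (top0 a) => // [b|]; last by rewrite /G -mulmxA Me eqxx.
    rewrite /G -mulmxA Mea; case: eqP => [tab|_]; last by rewrite mulmx0.
    have [->|b0] := eqVneq (qarr M b) 0; first by rewrite mulmx0.
    by rewrite -(tgt_inj (nl a Xa0) (nl b b0) tab).
  have : ((qidem M (t a))^T <= (qarr M a)^T)%MS.
    by rewrite submxE -[cokermx _]trmxK -trmx_mul -/G G0 trmx0.
  by case/submxP=> Z /(congr1 trmx); rewrite trmx_mul !trmxK => ->; exists Z^T.
have [y1 y1a] : exists y1, y1 *m qarr M a = qidem M (s a).
  pose W := qidem M (s a) *m cokermx (qarr M a).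
  have W0 : W = 0.
    apply: (soc0 a) => // [b|]; last by rewrite /W mulmxA Me eqxx.
    rewrite /W mulmxA Mae; case: eqP => [sab|_]; last by rewrite mul0mx.
    have [->|b0] := eqVneq (qarr M b) 0; first by rewrite mul0mx.
    by rewrite -(src_inj (nl a Xa0) (nl b b0) sab) mulmx_coker.
  have : (qidem M (s a) <= qarr M a)%MS by rewrite submxE -/W W0.
  by case/submxP=> Z ->; exists Z.
(* By [nocomp] and the two injectivity hypotheses, a nonzero arrow other than [a] touches neither
   endpoint of [a], so this sum commutes with all arrows. *)
have f1 : qidem M (s a) + qidem M (t a) = 1%:M.
  have [l fl] : exists l, qidem M (s a) + qidem M (t a) = l%:M.
    apply: endo_scalar => //; split=> [i|b].
      rewrite mulmxDl mulmxDr !Me ![_ == i]eq_sym.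
      by congr (_ + _); case: eqP => [->|].
    rewrite mulmxDl mulmxDr !Mea !Mae.
    have [->|b0] := eqVneq (qarr M b) 0; first by rewrite !if_same.
    rewrite (negPf (nocomp a b Xa0 b0)) [t a == s b]eq_sym (negPf (nocomp b a b0 Xa0)).
    rewrite add0r addr0; case: eqP => [/(tgt_inj (nl a Xa0) (nl b b0)) ->|tab].
      by rewrite eqxx.
    by case: eqP => // /(src_inj (nl a Xa0) (nl b b0)) ab; rewrite ab in tab.
  have := congr1 (mulmx (qarr M a)) fl.
  rewrite mulmxDr aes Mae [_ == s a]eq_sym (negPf (nl a Xa0)) addr0 mul_mx_scalar.
  by move=> /esym/(scaler_fix Xa0) l1; rewrite fl l1.
exists (inr a); split=> //; first exact: nl.
  move=> b ba; apply/eqP; apply: contraNT ba => b0.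
  have := congr1 (mulmx^~ (qarr M b)) f1.
  rewrite mul1mx mulmxDl !Mea (negPf (nocomp a b Xa0 b0)) add0r.
  case: eqP => [/(tgt_inj (nl a Xa0) (nl b b0)) -> //|_ b00].
  by rewrite -b00 eqxx in b0.
(* The left inverse also works on the right: [a y1 e_t = a y1 a y0 = a e_s y0 = a y0 = e_t]. *)
exists (y1 *m qidem M (t a)); split.
  by rewrite -mulmxA eta.
by rewrite -ay0 [y1 *m _]mulmxA y1a mulmxA aes.
Qed.


(** No arrow acting nontrivially ends at the top vertex, so projecting to that vertex factors
    through the top of [M]. In the uniserial case [e_s = 0] would give [a = a e_s = 0], then
    [e_t = a y = 0] and [1 = 0]. *)
Lemma shape_top u M : is_rad2_module s t M -> (0 < qdim M)%N -> has_shape u M ->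
  qidem M (top_vertex u) != 0 /\ forall b, qidem M (top_vertex u) *m qarr M b = 0.
Proof.
move=> [Me M1 Mea Mae Maa] M0.
have nz1 : (1%:M : 'M[F]_(qdim M)) != 0 by rewrite -mxrank_eq0 mxrank1 -lt0n.
case: u => [c [ec arr0]|a [nla e1 arr0 [y [ya ay]]]] /=.
  by split=> [|b]; rewrite ?ec ?eqxx // arr0 mulmx0.
split=> [|b]; last first.
  have [->|/arr0 ->] := eqVneq b a; last by rewrite mulmx0.
  by rewrite Mea (negPf nla).
apply: contraNneq nz1 => es0; rewrite -e1 es0 add0r -ay -[qarr M a]mul1mx -e1 es0.
have := Mae a (s a); rewrite eqxx es0 mulmx0 => <-.
by rewrite mulmx0 mul0mx.
Qed.

Lemma shape_socle u M : is_rad2_module s t M -> (0 < qdim M)%N -> has_shape u M ->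
  qidem M (socle_vertex u) != 0 /\
  forall b, qarr M b *m qidem M (socle_vertex u) = 0.
Proof.
move=> [Me M1 Mea Mae Maa] M0.
have nz1 : (1%:M : 'M[F]_(qdim M)) != 0 by rewrite -mxrank_eq0 mxrank1 -lt0n.
case: u => [c [ec arr0]|a [nla e1 arr0 [y [ya ay]]]] /=.
  by split=> [|b]; rewrite ?ec ?eqxx // arr0 mul0mx.
split=> [|b]; last first.
  have [->|/arr0 ->] := eqVneq b a; last by rewrite mul0mx.
  by rewrite Mae eq_sym (negPf nla).
apply: contraNneq nz1 => et0; rewrite -e1 et0 addr0 -ya.
have := Mea (t a) a; rewrite eqxx et0 mul0mx => <-.
by rewrite mulmx0.
Qed.

Lemma shape_support u M i : is_rad2_module s t M -> has_shape u M ->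
  i != top_vertex u -> i != socle_vertex u -> qidem M i = 0.
Proof.
move=> [Me _ _ _ _]; case: u => [c [ec _] /= ic _|a [_ e1 _ _] /= ias iat].
  by rewrite ec (negPf ic).
by rewrite -[LHS]mulmx1 -e1 mulmxDr !Me (negPf ias) (negPf iat) addr0.
Qed.

(** Were the two vertices equal, every linear map between the spaces at that vertex would give a
    module map from [M] through its top and the socle of [N] into [N]. All of these being zero
    contradicts that both idempotents are nonzero. *)
Lemma top_neq_socle u v M N :
    is_rad2_module s t M -> is_rad2_module s t N ->
    (0 < qdim M)%N -> (0 < qdim N)%N -> has_shape u M -> has_shape v N ->
  dimHom M N = 0%N -> top_vertex u != socle_vertex v.
Proof.
move=> mM mN M0 N0 uM vN H0; apply/eqP=> uv.
have [eu0 eub] := shape_top mM M0 uM; have [ev0 vb] := shape_socle mN N0 vN.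
have [[Me _ _ _ _] [Ne _ _ _ _]] := (mM, mN).
have [U| /eqP|/eqP] := @mulmx_sandwich_eq0 _ _ _ _ _
    (qidem N (socle_vertex v)) (qidem M (top_vertex u)).
- apply: hom_eq0 H0 _; split=> [i|b]; last first.
    by rewrite -!mulmxA eub !mulmx0 mulmxA vb mul0mx.
  rewrite !mulmxA Ne -mulmxA Me [i == _]eq_sym uv.
  by case: eqP => [->|]; rewrite ?mulmx0 ?mul0mx.
- by rewrite (negPf ev0).
- by rewrite (negPf eu0).
Qed.

(** A component [D b] vanishes by support, by orthogonality, or because the arrow of a uniserial
    member is invertible and the relations of length two apply. Only [D a], when both modules live
    on the same arrow [a], survives, and it is a coboundary. *)
Lemma dimExt1_shape_eq0 u v M N :
    is_rad2_module s t M -> is_rad2_module s t N -> has_shape u M -> has_shape v N ->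
    (u != v -> top_vertex u != socle_vertex v /\ top_vertex v != socle_vertex u) ->
    (forall b, ~ (u = inl (s b) /\ v = inl (t b))) ->
  dimExt1 s t M N = 0%N.
Proof.
move=> mM mN uM vN uv noarr; apply: dimExt1_eq0 => // D eD De DD.
have [[Me M1 Mea Mae Maa] [Ne N1 Nea Nae Naa]] := (mM, mN).
have D0s b : s b != top_vertex u -> s b != socle_vertex u -> D b = 0.
  move=> bt bs; have := De b (s b); rewrite eqxx => <-.
  by rewrite (shape_support mM uM bt bs) mulmx0.
have D0t b : t b != top_vertex v -> t b != socle_vertex v -> D b = 0.
  move=> bt bs; have := eD (t b) b; rewrite eqxx => <-.
  by rewrite (shape_support mN vN bt bs) mul0mx.
have allD0 : (forall b, D b = 0) -> exists2 phi : 'M[F]_(qdim N, qdim M),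
    (forall i, qidem N i *m phi = phi *m qidem M i) &
    forall a, D a = qarr N a *m phi - phi *m qarr M a.
  by move=> D0; exists 0 => [i|a]; rewrite ?D0 !mulmx0 !mul0mx ?subrr.
case: u => [c|a] in uM uv noarr D0s *; last first.
  case: (uM) => nla e1 arr0 [y [ya ay]].
  (* On [M], [e_(t a) = a y], and the relation for [b a] turns [D_b a] into [- b D_a]. Here [b] acts
     by zero on [N], since otherwise the top of [N] would be at [t a], the socle vertex of [M]. *)
  have Dt b : s b = t a -> D b = 0.
    move=> bta; have := De b (s b); rewrite eqxx bta -ay mulmxA => <-.
    have := DD b a; rewrite addrC => /eqP; rewrite addr_eq0 => /eqP ->.
    suff -> : qarr N b = 0 by rewrite mul0mx oppr0 mul0mx.
    case: v vN uv {noarr D0t} => [c' [_ ->] //|a' [nla' _ arr0' _]] uv.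
    have [ba'|/arr0' //] := eqVneq b a'.
    have aa' : a != a'.
      by apply: contraNneq nla => aa'; rewrite aa' -ba' bta ba' -aa'.
    have [|_] := uv _; first by apply: contraNneq aa' => -[->].
    by rewrite /= -ba' bta eqxx.
  have [va|va] := eqVneq (inr a) v.
    rewrite -va in vN D0t; case: vN => _ _ Narr0 [y' [ya' ay']].
    (* The remaining case is a loop at [s a]: on [N], [e_(s a) = y' a], and the relation for [a b]
       gives [a D_b = - D_a b = 0]. *)
    have Db b : b != a -> D b = 0.
      move=> ba; have [/Dt//|bt] := eqVneq (s b) (t a).
      have [bs|bs] := eqVneq (s b) (s a); last exact: D0s.
      have bl : s b = t b by apply/eqP; apply: contraNT ba => bl; apply/eqP/src_inj.
      have := eD (t b) b; rewrite eqxx -bl bs -ya' -mulmxA.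
      have := DD a b; rewrite arr0 // mulmx0 addr0 => ->.
      by rewrite mulmx0 => <-.
    have eDa : qidem N (t a) *m D a = D a by rewrite eD eqxx.
    have Dea : D a *m qidem M (s a) = D a by rewrite De eqxx.
    (* As [y'] inverts [a] on [N], this solves [a z = D_a]; the left factor keeps [z] at the vertex
       [s a]. *)
    pose z := qidem N (s a) *m y' *m D a.
    have ez i : qidem N i *m z = if i == s a then z else 0.
      by rewrite /z !mulmxA Ne; case: eqP => [->//|]; rewrite !mul0mx.
    have ze i : z *m qidem M i = if i == s a then z else 0.
      by rewrite /z -mulmxA De; case: eqP => // _; rewrite mulmx0.
    exists z => [i|b]; first by rewrite ez ze.
    have zX b' : z *m qarr M b' = 0.
      have [->|/arr0 ->] := eqVneq b' a; last by rewrite mulmx0.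
      have := ze (s a); rewrite eqxx => <-.
      by rewrite -mulmxA Mea (negPf nla) mulmx0.
    rewrite zX subr0; have [->|ba] := eqVneq b a; last by rewrite Db // Narr0 // mul0mx.
    by rewrite /z !mulmxA Nae eqxx ay' eDa.
  (* For different shapes, the arrows left to treat are the loops at [s a] and [a] itself;
     orthogonality and injectivity put their targets outside the support of [N]. *)
  apply: allD0 => b; have [tu tv] := uv va.
  have [/Dt//|bt] := eqVneq (s b) (t a).
  have [bs|bs] := eqVneq (s b) (s a); last exact: D0s.
  have ntv w : w = top_vertex v -> w = socle_vertex v \/ exists2 a', v = inr a' & w = s a'.
    by case: (v) => [c|a'] /= ->; [left | right; exists a'].
  have [bl|bl] := eqVneq (s b) (t b).
    have [tbv|tbv] := eqVneq (t b) (top_vertex v); last first.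
      by apply: D0t => //; rewrite -bl bs.
    have [tbs|[a' va' tba']] := ntv _ tbv.
      by move: tu; rewrite /= -bs bl tbs eqxx.
    rewrite va' in vN va; case: vN => nla' _ _ _.
    by case/eqP: va; congr inr; apply: src_inj; rewrite // -bs bl tba'.
  have ba : b = a by apply: src_inj.
  rewrite ba in bl *; apply: D0t; first by rewrite eq_sym.
  apply/eqP=> tav; case: (v) vN va tv tav => [c _ _ /= tv tav|a' [nla' _ _ _] va _ tav].
    by rewrite tav eqxx in tv.
  by case/eqP: va; congr inr; apply: tgt_inj.
apply: allD0 => b.
have [bc|bc] := eqVneq (s b) c; last exact: D0s.
case: v vN uv noarr D0t => [c' _ _ noarr D0t|a'].
  have [bc'|bc'] := eqVneq (t b) c'; last exact: D0t.
  by case: (noarr b); rewrite bc bc'.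
move=> [nla' _ _ [y' [ya' ay']]] uv _ D0t; have [|/= cta' sa'c] := uv _; first by [].
(* At the top of the uniserial [N], again [e_(s a') = y' a'], while [a' D_b = - D_(a') b = 0]
   because arrows act by zero on [M]. *)
have [bs|bs] := eqVneq (t b) (s a').
  have := eD (t b) b; rewrite eqxx bs -ya' -mulmxA.
  have := DD a' b; case: uM => _ ->; rewrite mulmx0 addr0 => ->.
  by rewrite mulmx0 => <-.
apply: D0t => //=; apply/eqP=> bt.
have bl : s b != t b by rewrite bc bt.
have ba' : b = a' by apply: tgt_inj.
by rewrite -ba' bc eqxx in sa'c.
Qed.

End Classification.

(** * Endomorphisms and self-extensions of multiples of a simple module *)

Lemma dimHom_simple_self c M :
  simple_at c M -> dimHom M M = (qdim M * qdim M)%N.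
Proof.
move=> [ec arr0]; rewrite /dimHom.
have -> : lker (linfun (@hom_defect F n Ar M M)) = fullv.
  apply/vspaceP=> f; rewrite memvf; apply/mem_homP; split=> [k|a] /=.
    by rewrite ec; case: eqP; rewrite ?mul1mx ?mulmx1 ?mul0mx ?mulmx0.
  by rewrite arr0 mul0mx mulmx0.
by rewrite dimvf.
Qed.

(** Idempotents act by 0 or 1 and arrows by 0, so coboundaries vanish. A cocycle is zero except for
    an arbitrary matrix on each loop at [c]. *)
Lemma dimExt1_simple_self c M : simple_at c M ->
  dimExt1 s t M M = (#|[pred a | (s a == c) && (t a == c)]| * (qdim M * qdim M))%N.
Proof.
move=> [ec arr0]; rewrite /dimExt1.
pose LT := {a | (s a == c) && (t a == c)}.
have -> : limg (linfun (@coboundary F n Ar M M)) = 0%VS.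
  apply/eqP; rewrite -subv0; apply/subvP=> d /memv_imgP[phi _ ->].
  rewrite lfunE memv0; apply/eqP/ffunP=> -[i|a]; rewrite !ffunE /=.
    by rewrite ec; case: eqP; rewrite ?mul1mx ?mulmx1 ?mul0mx ?mulmx0 subrr.
  by rewrite arr0 mul0mx mulmx0 subrr.
rewrite dimv0 subn0.
(* Extension by zero from the loops at [c]; its image turns out to be the cocycle space. *)
pose E (h : {ffun LT -> 'M[F]_(qdim M)}) : {ffun 'I_n + Ar -> 'M[F]_(qdim M)} :=
  [ffun g => if g is inr a then oapp h 0 (insub a) else 0].
have linE : linear E.
  move=> k h1 h2; apply/ffunP=> -[i|a]; rewrite !ffunE ?scaler0 ?addr0 //.
  by case: insub => [l|] /=; rewrite ?ffunE // scaler0 addr0.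
pose LE := GRing.isLinear.Build _ _ _ _ E linE.
pose lE : {linear _ -> _} := HB.pack E LE.
have injE : lker (linfun lE) == 0%VS.
  apply/lker0P=> h1 h2; rewrite !lfunE /= => /ffunP h12; apply/ffunP=> l.
  by have := h12 (inr (val l)); rewrite !ffunE valK.
have -> : lker (linfun (@cocycle_defect F n Ar s t M M)) = limg (linfun lE).
  apply/eqP; rewrite eqEsubv; apply/andP; split; apply/subvP=> d.
    rewrite memv_ker lfunE => /eqP/ffunP Zd.
    apply/memv_imgP; exists [ffun l : LT => d (inr (val l))]; rewrite ?memvf //.
    have dc : d (inl c) = 0.
      have := Zd (inl (inl (inl (inl (c, c))))); rewrite !ffunE ec !eqxx.
      by rewrite mul1mx mulmx1 addrK.
    rewrite lfunE; apply/ffunP=> -[i|a]; rewrite !ffunE /=.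
      have [->//|ic] := eqVneq i c.
      have := Zd (inl (inl (inl (inl (i, c))))); rewrite !ffunE !ec eqxx (negPf ic).
      by rewrite mul0mx add0r mulmx1 subr0.
    case: insubP => [l _ <-|]; first by rewrite /= ffunE.
    rewrite negb_and => /orP[sac|tac] /=.
      have := Zd (inl (inr (a, c))); rewrite !ffunE ec arr0 eqxx [c == _]eq_sym.
      by rewrite (negPf sac) mul0mx add0r mulmx1 subr0.
    have := Zd (inl (inl (inr (c, a)))); rewrite !ffunE ec arr0 eqxx [c == _]eq_sym.
    by rewrite (negPf tac) mul1mx mulmx0 addr0 subr0.
  move=> /memv_imgP[h _ ->]; rewrite memv_ker !lfunE /=.
  apply/eqP/ffunP=> -[[[[[i j]|[]]|[i a]]|[a j]]|[a b]]; rewrite !ffunE ?arr0.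
  - by rewrite mul0mx mulmx0 if_same !addr0 subrr.
  - by rewrite big1 // => i _; rewrite ffunE.
  - rewrite mul0mx addr0 ec; case: insubP => [l /andP[_ /eqP tac] _|_] /=.
      by rewrite tac; case: eqP; rewrite ?mul1mx ?mul0mx subrr.
    by rewrite mulmx0 if_same subrr.
  - rewrite mulmx0 add0r ec; case: insubP => [l /andP[/eqP sac _] _|_] /=.
      by rewrite sac; case: eqP; rewrite ?mulmx1 ?mulmx0 subrr.
    by rewrite mul0mx if_same subrr.
  - by rewrite mul0mx mulmx0 addr0.
rewrite limg_dim_eq; last by rewrite (eqP injE) capv0.
by rewrite dimvf /dim /= card_sig.
Qed.

End Rad2Modules.
End Modules.

(* Look at a coordinate of least weight in the support of an eigenvector. *)
Lemma weighted_triangular_eigenvalue (K : fieldType) (m : nat) (B : 'M[K]_m)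
    (w : 'I_m -> nat) (l : K) :
  (forall i j, i != j -> B i j != 0 -> (w i < w j)%N) ->
  eigenvalue B l -> exists j, l = B j j.
Proof.
move=> Bw /eigenvalueP[v vB /rV0Pn[j0 vj0]].
case: (@arg_minnP _ j0 (fun j => v 0 j != 0) w vj0) => j vj minj; exists j.
have /rowP/(_ j) := vB; rewrite !mxE (bigD1 j) //= big1 ?addr0 => [|i ij].
  by rewrite mulrC => /(mulIf vj).
have [->|vi] := eqVneq (v 0 i) 0; first by rewrite mul0r.
have [->|/(Bw _ _ ij)] := eqVneq (B i j) 0; first by rewrite mulr0.
by rewrite ltnNge minj.
Qed.

(** * The line quiver with loops: its arrows, simple modules and adjacency eigenvalues *)

Section LinearQuiver.
Variables (n : nat) (N : 'I_n -> nat).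

Lemma arrA_nonloop (a : arrA N) : srcA a != tgtA a ->
  (tgtA a = (srcA a).+1 :> nat) /\ exists k, a = inl k.
Proof.
case: a => [[k k0] _|l]; last by rewrite eqxx.
by split; [rewrite /= prednK | exists (Sub k k0)].
Qed.

Lemma tgtA_inj (a b : arrA N) :
  srcA a != tgtA a -> srcA b != tgtA b -> tgtA a = tgtA b -> a = b.
Proof.
move=> /arrA_nonloop[_ [k ->]] /arrA_nonloop[_ [l ->]] /= kl.
by congr inl; apply: val_inj.
Qed.

Lemma srcA_inj (a b : arrA N) :
  srcA a != tgtA a -> srcA b != tgtA b -> srcA a = srcA b -> a = b.
Proof.
move=> na nb ab; apply: tgtA_inj => //; apply/ord_inj.
by rewrite (proj1 (arrA_nonloop na)) (proj1 (arrA_nonloop nb)) ab.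
Qed.

Lemma card_loopsA c : #|[pred a : arrA N | (srcA a == c) && (tgtA a == c)]| = N c.
Proof.
pose f (j : 'I_(N c)) : arrA N := inr (Tagged (fun i => 'I_(N i)) j).
rewrite -[RHS]card_ord -(card_codom (f := f)); last first.
  by move=> i j [] /eqP; rewrite -tag_eqE /tag_eq eqxx tagged_asE => /eqP.
apply: eq_card => a; rewrite !inE; apply/idP/codomP => [|[j ->]]; last first.
  by rewrite /= eqxx.
case: a => [k|[i j]] /=.
  (* An arrow of the line is not a loop: [k] is positive, so the truncated predecessor [k.-1]
     differs from [k]. *)
  case/andP=> /eqP sc /eqP tc.
  have kk : (nat_of_ord (val k)).-1 = val k.
    by have := congr1 (@nat_of_ord n) (etrans sc (esym tc)).
  have k0 : (0 < val k)%N := valP k.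
  by move: k0; rewrite -ltn_predL kk ltnn.
by rewrite andbb => /eqP ic; case: _ / ic in f *; exists j.
Qed.

Definition simpleA (F : fieldType) (c : 'I_n) : qrep F n (arrA N) :=
  @QRep F n (arrA N) 1 (fun i => if i == c then 1%:M else 0) (fun _ => 0).

Lemma brick_set_simpleA (F : fieldType) (c : 'I_n) :
  brick_set (@srcA n N) (@tgtA n N) (fun _ : 'I_1 => simpleA F c).
Proof.
split=> [_|i j].
  split=> //; split=> /= [i j||i a|a j|a b]; rewrite ?mul0mx ?mulmx0 ?if_same //.
    have [->|ic] := eqVneq i c; last by rewrite mul0mx if_same.
    by rewrite mul1mx eq_sym.
  by rewrite -big_mkcond big_pred1_eq.
by rewrite !ord1 eqxx (dimHom_simple_self (c := c)).
Qed.

Lemma eigenvalue_adjacencyA (F : fieldType) m (X : 'I_m -> qrep F n (arrA N)) l :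
    brick_set (@srcA n N) (@tgtA n N) X ->
    eigenvalue (adjacency (@srcA n N) (@tgtA n N) X) l ->
  l = 0 \/ exists c, l = (N c)%:R.
Proof.
move=> [mX dX] eig.
have /fin_all_exists[u uX] i : exists u, has_shape (@srcA n N) (@tgtA n N) u (X i).
  have [mXi Xi0] := mX i.
  by apply: brick_has_shape => //; [exact: srcA_inj|exact: tgtA_inj|rewrite dX eqxx].
have ts i j : i != j ->
    top_vertex (@srcA n N) (u i) != socle_vertex (@tgtA n N) (u j).
  move=> ij; have [[mi i0] [mj j0]] := (mX i, mX j).
  by apply: (top_neq_socle mi mj) => //; rewrite dX (negPf ij).
(* The weight of a member is the index of its top vertex. A nonzero off-diagonal entry needs simples
   joined by a non-loop arrow, along which the index grows by one. *)
have [i j ij|j ->] := weighted_triangular_eigenvalue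
    (w := fun i => top_vertex (@srcA n N) (u i)) _ eig.
  rewrite mxE pnatr_eq0.
  have [/existsP[b /andP[/eqP ui /eqP uj]] _|/existsPn nob] := boolP [exists b : arrA N,
      (u i == inl (srcA b)) && (u j == inl (tgtA b))].
    have := ts i j ij; rewrite ui uj /= => /arrA_nonloop[-> _].
    exact: ltnSn.
  case/eqP; apply: (dimExt1_shape_eq0 (@srcA_inj) (@tgtA_inj)
      (mX i).1 (mX j).1 (uX i) (uX j)).
    by move=> _; split; apply: ts; rewrite // eq_sym.
  by move=> b [ui uj]; have := nob b; rewrite ui uj !eqxx.
rewrite mxE; have [[c uc]|noc] : (exists c, u j = inl c) \/ (forall c, u j <> inl c).
  by case: (u j) => [c|a]; [left; exists c | right].
  (* The entry is [N c] times the square of [qdim], and that square is the dimension of the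
     endomorphism space, which is 1 for a brick. *)
  right; exists c; have sX := uX j; rewrite uc /= in sX.
  by rewrite (dimExt1_simple_self _ _ sX) card_loopsA -(dimHom_simple_self sX)
    dX eqxx muln1.
left; rewrite (dimExt1_shape_eq0 (@srcA_inj) (@tgtA_inj)
  (mX j).1 (mX j).1 (uX j) (uX j)) //.
- by rewrite eqxx.
- by move=> b [/noc].
Qed.

End LinearQuiver.

Unset Implicit Arguments.

Theorem theorem5p1 (k : closedFieldType) (n : nat) (N : 'I_n -> nat)
    (hn : (1 <= n)%N) :
  fpd_eq k (@srcA n N) (@tgtA n N) (\max_(i < n) N i)%N%:R.
Proof.
split; first exact: realn.
split=> [r [m [X [bX]]]|eps eps0].
  rewrite /is_spectral_radius; case: eqP => [_ ->|_ [[l eig <-] _]].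
    (* The empty brick set has radius 0. *)
    exact: ler0n.
  have [->|[c ->]] := eigenvalue_adjacencyA bX eig; first by rewrite normr0 ler0n.
  by rewrite normr_nat ler_nat leq_bigmax.
(* As [n] is positive, the maximum is attained at some [c]. The single simple at [c] realises it, so
   one value serves every [eps]. *)
have [|c Nc] := @bigop.eq_bigmax _ N; first by rewrite card_ord.
exists (N c)%:R; last by rewrite Nc ltrBlDr ltrDl.
exists 1%N, (fun _ => simpleA N k c); split; first exact: brick_set_simpleA.
have adjE : adjacency (@srcA n N) (@tgtA n N) (fun _ : 'I_1 => simpleA N k c)
    = (N c)%:R%:M.
  apply/matrixP=> i j; rewrite !ord1 !mxE eqxx mulr1n.
  by rewrite (dimExt1_simple_self _ _ (c := c)) // card_loopsA !muln1.
rewrite /is_spectral_radius /= adjE; split.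
  exists (N c)%:R; last exact: normr_nat.
  apply/eigenvalueP; exists 1%:M; first by rewrite mul1mx scalemx1.
  by rewrite -mxrank_eq0 mxrank1.
move=> l /eigenvalueP[v]; rewrite mul_mx_scalar => /eqP; rewrite -subr_eq0 -scalerBl.
rewrite scaler_eq0 subr_eq0 => /orP[/eqP <-|/eqP ->]; last by rewrite eqxx.
by rewrite normr_nat.
Qed.
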